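(* Fix $n\geq 2$. Then for any finite tuple $\bar a$ of elements of $\mathbb{F}_{n+1}$, the conjugacy class $[e_{n+1}]_{E_1}$ is not interalgebraic with $\bar a$ over $\mathbb{F}_n$, i.e. it is not the case that both $\bar a\in acl^{eq}(\mathbb{F}_n\cup\{[e_{n+1}]_{E_1}\})$ and $[e_{n+1}]_{E_1}\in acl^{eq}(\mathbb{F}_n\cup\bar a)$.
   Context: $\mathbb{F}_\omega$ is the free group with basis $e_1,e_2,\ldots$ and $\mathbb{F}_k=\langle e_1,\ldots,e_k\rangle$. $E_1$ is the equivalence relation of conjugacy, and $[x]_{E_1}$ is the conjugacy class of $x$ viewed as an imaginary element. Algebraic closure is computed in the eq-expansion $\mathbb{M}^{eq}$ of a saturated model $\mathbb{M}$ of the theory of non-abelian free groups (language $(\cdot,{}^{-1},1)$) having $\mathbb{F}_2\prec\mathbb{F}_3\prec\cdots\prec\mathbb{F}_\omega$ as elementary substructures; $\mathbb{M}^{eq}$ adds a sort of classes for each $\emptyset$-definable equivalence relation, and $acl^{eq}(A)$ is the set of elements of $\mathbb{M}^{eq}$ in a finite $A$-definable set. *)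

(* Defs.v *)
From mathcomp Require Import all_boot.
From mathcomp Require Import boolp classical_sets functions cardinality.

Set Implicit Arguments.
Unset Strict Implicit.
Unset Printing Implicit Defensive.

Local Open Scope classical_set_scope.
Local Open Scope card_scope.
Local Open Scope group_scope.

(** * First-order logic in the language (·, ⁻¹, 1) *)

(* [term n] and [formula n] have their free variables among the n variables
   indexed by 'I_n; variable 0 of the body of [FAll] is the bound one. *)
Inductive term (n : nat) : Type :=
| TVar of 'I_n
| TOne
| TMul of term n & term n
| TInv of term n.

Arguments TOne {n}.

Inductive formula : nat -> Type :=
| FEq n : term n -> term n -> formula n
| FFalse n : formula n
| FImp n : formula n -> formula n -> formula n
| FAll n : formula n.+1 -> formula n.

Arguments FFalse {n}.

Section Satisfaction.
Variable G : groupType.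

Definition scons n (x : G) (v : 'I_n -> G) : 'I_n.+1 -> G :=
  fun i => if unlift ord0 i is Some j then v j else x.

Fixpoint teval n (v : 'I_n -> G) (t : term n) : G :=
  match t with
  | TVar i => v i
  | TOne => 1
  | TMul t1 t2 => teval v t1 * teval v t2
  | TInv t1 => (teval v t1)^-1
  end.

(* Satisfaction in the substructure of G with universe D: it is only meant for
   subgroups D and assignments v with values in D. [sat setT] is satisfaction
   in G itself. *)
Fixpoint sat (D : set G) n (phi : formula n) : ('I_n -> G) -> Prop :=
  match phi in formula n return ('I_n -> G) -> Prop with
  | FEq _ t u => fun v => teval v t = teval v u
  | FFalse _ => fun _ => False
  | FImp _ phi1 phi2 => fun v => sat D phi1 v -> sat D phi2 v
  | FAll _ phi1 => fun v => forall x, D x -> sat D phi1 (scons x v)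
  end.

Definition is_subgroup (H : set G) : Prop :=
  [/\ H 1, forall x y, H x -> H y -> H (x * y) & forall x, H x -> H x^-1].

Definition elementary_sub (D D' : set G) : Prop :=
  [/\ is_subgroup D, is_subgroup D', D `<=` D' &
      forall n (phi : formula n) (v : 'I_n -> G),
        (forall i, D (v i)) -> (sat D phi v <-> sat D' phi v)].

Definition generated (A : set G) : set G :=
  [set x | forall H, is_subgroup H -> A `<=` H -> H x].

(* A letter (i, b) stands for e_i if b = false and for e_i⁻¹ if b = true. *)
Definition word_eval (I : Type) (e : I -> G) (w : seq (I * bool)) : G :=
  foldr (fun l g => (if l.2 then (e l.1)^-1 else e l.1) * g) 1 w.

End Satisfaction.

Definition reduced (I : Type) (w : seq (I * bool)) : Prop :=
  forall u v i b, w <> u ++ (i, b) :: (i, ~~ b) :: v.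

Definition free_basis (G : groupType) (H : set G) (I : Type) (e : I -> G)
    : Prop :=
  H = generated (range e) /\
  forall w : seq (I * bool), reduced w -> w <> [::] -> word_eval e w <> 1.

Definition nonabelian_free (G : groupType) : Prop :=
  (exists (I : Type) (e : I -> G), free_basis [set: G] e) /\
  (exists x y : G, x * y <> y * x).

Definition free_theory : set (formula 0) :=
  [set phi | forall G : groupType, nonabelian_free G ->
     forall v : 'I_0 -> G, sat setT phi v].

Definition models (M : groupType) (T : set (formula 0)) : Prop :=
  forall phi, T phi -> forall v : 'I_0 -> M, sat setT phi v.

(** * Saturation *)

Section Saturation.
Variable M : groupType.

(* A formula in the single variable 0, the other variables being replaced by
   the parameters [pf_par]. *)
Record pformula := PFormula {
  pf_n : nat;
  pf_body : formula pf_n.+1;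
  pf_par : 'I_pf_n -> M
}.

Definition pf_over (A : set M) (p : pformula) : Prop :=
  forall i, A (pf_par (p := p) i).

Definition psat (p : pformula) (x : M) : Prop :=
  sat setT (pf_body p) (scons x (pf_par (p := p))).

Definition finitely_satisfiable (P : set pformula) : Prop :=
  forall Q, finite_set Q -> Q `<=` P ->
    exists x, forall p, Q p -> psat p x.

(* [~ ([set: M] #<= A)] says |A| < |M|. *)
Definition saturated : Prop :=
  forall A : set M, ~ ([set: M] #<= A) ->
  forall P : set pformula, (forall p, P p -> pf_over A p) ->
    finitely_satisfiable P -> exists x, forall p, P p -> psat p x.

End Saturation.

(** * The eq-expansion of M *)

Section Eq.
Variable M : groupType.

Definition joinv k (x y : 'I_k -> M) : 'I_(k + k) -> M :=
  fun i => match fintype.split i with inl j => x j | inr j => y j end.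

Record def_equiv := DefEquiv {
  de_ar : nat;
  de_rel : ('I_de_ar -> M) -> ('I_de_ar -> M) -> Prop;
  de_refl : forall x, de_rel x x;
  de_sym : forall x y, de_rel x y -> de_rel y x;
  de_trans : forall x y z, de_rel x y -> de_rel y z -> de_rel x z;
  de_def : exists phi : formula (de_ar + de_ar),
    forall x y, de_rel x y <-> sat setT phi (joinv x y)
}.

Inductive eqsort : Type := Home | Quot of def_equiv.

Definition eq_class (E : def_equiv) : Type :=
  {C : set ('I_(de_ar E) -> M) | exists x, C = [set y | de_rel (d := E) x y]}.

Definition proj (E : def_equiv) (x : 'I_(de_ar E) -> M) : eq_class E :=
  exist _ [set y | de_rel (d := E) x y] (ex_intro _ x erefl).

Definition eqcarrier (s : eqsort) : Type :=
  match s with Home => M | Quot E => eq_class E end.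

(* A variable of sort s in a context, i.e. a list of sorts. *)
Inductive eqvar : seq eqsort -> eqsort -> Type :=
| VZ s c : eqvar (s :: c) s
| VS s s' c : eqvar c s -> eqvar (s' :: c) s.

Inductive eqterm (c : seq eqsort) : eqsort -> Type :=
| QVar s : eqvar c s -> eqterm c s
| QOne : eqterm c Home
| QMul : eqterm c Home -> eqterm c Home -> eqterm c Home
| QInv : eqterm c Home -> eqterm c Home
| QProj (E : def_equiv) :
    ('I_(de_ar E) -> eqterm c Home) -> eqterm c (Quot E).

Inductive eqformula : seq eqsort -> Type :=
| QEq c s : eqterm c s -> eqterm c s -> eqformula c
| QFalse c : eqformula c
| QImp c : eqformula c -> eqformula c -> eqformula c
| QAll c s : eqformula (s :: c) -> eqformula c.

Fixpoint eqenv (c : seq eqsort) : Type :=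
  if c is s :: c' then (eqcarrier s * eqenv c')%type else unit.

Fixpoint lookup c s (i : eqvar c s) : eqenv c -> eqcarrier s :=
  match i in eqvar c s return eqenv c -> eqcarrier s with
  | VZ _ _ => fun r => r.1
  | VS _ _ _ j => fun r => lookup j r.2
  end.

Fixpoint eqteval c (r : eqenv c) s (t : eqterm c s) : eqcarrier s :=
  match t in eqterm _ s return eqcarrier s with
  | QVar _ i => lookup i r
  | QOne => (1 : M)
  | QMul t1 t2 => (eqteval r t1 : M) * (eqteval r t2 : M)
  | QInv t1 => (eqteval r t1 : M)^-1
  | QProj _ ts => proj (fun i => eqteval r (ts i))
  end.

Fixpoint eqsat c (phi : eqformula c) : eqenv c -> Prop :=
  match phi in eqformula c return eqenv c -> Prop with
  | QEq _ _ t u => fun r => eqteval r t = eqteval r u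
  | QFalse _ => fun _ => False
  | QImp _ phi1 phi2 => fun r => eqsat phi1 r -> eqsat phi2 r
  | QAll _ s phi1 => fun r => forall x : eqcarrier s, eqsat phi1 (x, r)
  end.

Definition eqelt : Type := {s : eqsort & eqcarrier s}.

Fixpoint env_in (A : set eqelt) (c : seq eqsort) : eqenv c -> Prop :=
  match c return eqenv c -> Prop with
  | [::] => fun _ => True
  | s :: c' => fun r => A (existT eqcarrier s r.1) /\ env_in A r.2
  end.

Definition definable_over (A : set eqelt) (s : eqsort) (X : set (eqcarrier s))
    : Prop :=
  exists (c : seq eqsort) (phi : eqformula (s :: c)) (r : eqenv c),
    env_in A r /\ X = [set x | eqsat phi (x, r)].

Definition acleq (A : set eqelt) : set eqelt :=
  [set b | exists X : set (eqcarrier (projT1 b)),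
     [/\ definable_over A X, finite_set X & X (projT2 b)]].

Definition real (x : M) : eqelt := existT eqcarrier Home x.

Definition conj_rel (x y : 'I_1 -> M) : Prop :=
  exists g : M, y ord0 = x ord0 ^ g.

Lemma conj_rel_refl x : conj_rel x x.
Proof. by exists 1; rewrite conjg1. Qed.

Lemma conj_rel_sym x y : conj_rel x y -> conj_rel y x.
Proof. by case=> g yE; exists g^-1; rewrite yE conjgK. Qed.

Lemma conj_rel_trans x y z : conj_rel x y -> conj_rel y z -> conj_rel x z.
Proof. by case=> g yE [h zE]; exists (g * h); rewrite conjgM -yE. Qed.

(* ¬ ∀ g, ¬ (y = g⁻¹ (x g)), with g, x, y the variables 0, 1, 2. *)
Definition conj_formula : formula (1 + 1) :=
  let g := TVar (Ordinal (isT : 0 < 3)) in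
  let x := TVar (Ordinal (isT : 1 < 3)) in
  let y := TVar (Ordinal (isT : 2 < 3)) in
  FImp (FAll (FImp (FEq y (TMul (TInv g) (TMul x g))) FFalse)) FFalse.

Lemma conj_rel_def : exists phi : formula (1 + 1),
  forall x y, conj_rel x y <-> sat setT phi (joinv x y).
Proof.
exists conj_formula => x y.
have E0 g : scons g (joinv x y) (Ordinal (isT : 0 < 3)) = g.
  by rewrite /scons; case: unliftP => // j /(congr1 val).
have E1 g : scons g (joinv x y) (Ordinal (isT : 1 < 3)) = x ord0.
  rewrite /scons; case: unliftP => [j|] /(congr1 val) //= [jE].
  rewrite /joinv; case: fintype.splitP => [k _|k]; first by rewrite (ord1 k).
  by move=> jk; move: jE; rewrite jk.
have E2 g : scons g (joinv x y) (Ordinal (isT : 2 < 3)) = y ord0.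
  rewrite /scons; case: unliftP => [j|] /(congr1 val) //= [jE].
  rewrite /joinv; case: fintype.splitP => [k|k _]; last by rewrite (ord1 k).
  by move=> jk; move: jE; rewrite jk (ord1 k).
rewrite /conj_formula /=; split.
  by case=> g yE /(_ g I); apply; rewrite E0 E1 E2 yE.
move=> H; apply: contrapT => N; apply: H => g _.
by rewrite E0 E1 E2 => yE; apply: N; exists g.
Qed.

Definition E1 : def_equiv :=
  DefEquiv conj_rel_refl conj_rel_sym conj_rel_trans conj_rel_def.

Definition conj_class (x : M) : eqelt :=
  existT eqcarrier (Quot E1) (proj (E := E1) (fun _ => x)).

End Eq.

(** * The chain F_2 ≺ F_3 ≺ ... ≺ F_ω ≺ M *)

(* Indices are shifted by one: [e i] is the basis element e_{i+1}, so that
   [Fk e k] is generated by e_1, ..., e_k. *)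
Definition Fk (M : groupType) (e : nat -> M) (k : nat) : set M :=
  generated [set e i | i in [set i | (i < k)%N]].

Definition Fomega (M : groupType) (e : nat -> M) : set M :=
  generated (range e).

Record ambient_model (M : groupType) (e : nat -> M) : Prop := AmbientModel {
  am_theory : models M free_theory;
  am_saturated : saturated M;
  am_basis : free_basis (Fomega e) e;
  am_chain : forall k, (2 <= k)%N -> elementary_sub (Fk e k) (Fk e k.+1);
  am_chain_omega : forall k, (2 <= k)%N -> elementary_sub (Fk e k) (Fomega e);
  am_elementary : elementary_sub (Fomega e) [set: M]
}.

(* Main.v *)
(* Let F be the free group on e_1, e_2, ..., an elementary substructure of M.
   Formulas of M^eq translate to formulas of M on representatives, so a set
   definable in M^eq over A is stable under every automorphism of F that fixes
   A, as far as its elements with representatives in F are concerned.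

   For k >= 1 the automorphism s_k of F that replaces e_{n+1} by its conjugate
   by e_{n+1+k} fixes F_n and the class of e_{n+1}.  If a in F_{n+1} is
   algebraic over these, then s_j(a) = s_k(a) for some j <> k.  Map F to the
   wreath product of F by Z/2 by sending e_i (i <= n+1) to (e_i, 1), e_{n+1+k}
   to the swap and the other generators to 1: then s_j(a) goes to (a, 1), and
   the first coordinate of the image of s_k(a) is a with e_{n+1} deleted, which
   lies in F_n.  Hence a is in F_n.

   It remains to see that the class of e_{n+1} is not algebraic over F_n:
   exchanging e_{n+1} with e_{n+1+k} fixes F_n, and e_{n+1+j}, e_{n+1+k} are
   not conjugate for j <> k, as an endomorphism of F can kill only one of
   them. *)

Require Import Defs.
From HB Require Import structures.
From mathcomp Require Import all_boot.
From mathcomp Require Import boolp classical_sets functions cardinality.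

Set Implicit Arguments.
Unset Strict Implicit.
Unset Printing Implicit Defensive.

Local Open Scope classical_set_scope.
Local Open Scope group_scope.

(** * Substitution *)

Fixpoint tsubst n m (s : 'I_n -> term m) (t : term n) : term m :=
  match t with
  | TVar i => s i
  | TOne => TOne
  | TMul t1 t2 => TMul (tsubst s t1) (tsubst s t2)
  | TInv t1 => TInv (tsubst s t1)
  end.

Definition upsubst n m (s : 'I_n -> term m) : 'I_n.+1 -> term m.+1 :=
  fun i => if unlift ord0 i is Some j
           then tsubst (fun k => TVar (lift ord0 k)) (s j) else TVar ord0.

Fixpoint fsubst n (phi : formula n) : forall m, ('I_n -> term m) -> formula m :=
  match phi in formula n return forall m, ('I_n -> term m) -> formula m with
  | FEq _ t u => fun m s => FEq (tsubst s t) (tsubst s u)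
  | FFalse _ => fun m s => FFalse
  | FImp _ phi1 phi2 => fun m s => FImp (fsubst phi1 s) (fsubst phi2 s)
  | FAll _ phi1 => fun m s => FAll (fsubst phi1 (upsubst s))
  end.

(** The innermost quantifier binds variable 0 of the block. The annotation holds by conversion:
    [k'.+1 + n] computes to [(k' + n).+1]. *)
Fixpoint FAlln k n : formula (k + n) -> formula n :=
  match k return formula (k + n) -> formula n with
  | 0 => id
  | k'.+1 => fun phi => FAlln (FAll (phi : formula (k' + n).+1))
  end.

(** For two group tuples of equal length this is [joinv] up to conversion. Entries of any type are
    allowed so that tuples of terms can be concatenated too. *)
Definition vcat T k n (x : 'I_k -> T) (v : 'I_n -> T) : 'I_(k + n) -> T :=
  fun i => match fintype.split i with inl j => x j | inr j => v j end.

Lemma vcat_lshift T k n (x : 'I_k -> T) (v : 'I_n -> T) i :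
  vcat x v (lshift n i) = x i.
Proof. by rewrite /vcat -[lshift n i]/(unsplit (inl i)) unsplitK. Qed.

Lemma vcat_rshift T k n (x : 'I_k -> T) (v : 'I_n -> T) i :
  vcat x v (rshift k i) = v i.
Proof. by rewrite /vcat -[rshift k i]/(unsplit (inr i)) unsplitK. Qed.

Lemma vcat_map T U (f : T -> U) k n (x : 'I_k -> T) (v : 'I_n -> T) :
  vcat (fun i => f (x i)) (fun i => f (v i)) = fun i => f (vcat x v i).
Proof. by apply: funext => i; rewrite /vcat; case: fintype.split. Qed.

Section Substitution.
Variable G : groupType.

Lemma scons0 n (x : G) (v : 'I_n -> G) : scons x v ord0 = x.
Proof. by rewrite /scons unlift_none. Qed.

Lemma scons_lift n (x : G) (v : 'I_n -> G) i : scons x v (lift ord0 i) = v i.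
Proof. by rewrite /scons liftK. Qed.

Lemma scons_eta n (w : 'I_n.+1 -> G) :
  scons (w ord0) (fun i => w (lift ord0 i)) = w.
Proof.
by apply: funext => i; rewrite /scons; case: unliftP => [j|] ->.
Qed.

Lemma teval_subst n m (s : 'I_n -> term m) (v : 'I_m -> G) t :
  teval v (tsubst s t) = teval (fun i => teval v (s i)) t.
Proof. by elim: t => //= [t -> u ->|t ->]. Qed.

Lemma sat_subst D n (phi : formula n) m (s : 'I_n -> term m) (v : 'I_m -> G) :
  sat D (fsubst phi s) v <-> sat D phi (fun i => teval v (s i)).
Proof.
elim: phi m s v => {n} [n t u|n|n p IHp q IHq|n p IHp] m s v //=.
- by rewrite !teval_subst.
- by rewrite IHp IHq.
suff E x : (fun i => teval (scons x v) (upsubst s i)) =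
           scons x (fun i => teval v (s i)).
  by split=> H x Dx; move: (H x Dx); rewrite IHp E.
apply: funext => i; rewrite /upsubst; case: unliftP => [j|] ->.
  rewrite scons_lift teval_subst; congr teval.
  by apply: funext => k /=; rewrite scons_lift.
by rewrite /= !scons0.
Qed.

Lemma sat_alln k n (phi : formula (k + n)) (v : 'I_n -> G) :
  sat setT (FAlln phi) v <-> forall x : 'I_k -> G, sat setT phi (vcat x v).
Proof.
elim: k phi => [|k IHk] phi.
  have E (x : 'I_0 -> G) : vcat x v = v.
    apply: funext => i; have {1}-> : i = rshift 0 i by exact: val_inj.
    exact: vcat_rshift.
  split=> [H x|/(_ (fun i => v (widen_ord (leq0n n) i)))]; rewrite E //.
have E (w : 'I_k.+1 -> G) :
    scons (w ord0) (vcat (fun i => w (lift ord0 i)) v) = vcat w v.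
  rewrite -[RHS]scons_eta; congr scons.
    have -> : ord0 = lshift n (ord0 : 'I_k.+1) :> 'I_(k.+1 + n).
      exact: val_inj.
    by rewrite vcat_lshift.
  apply: funext => i; rewrite {1}/vcat.
  case: splitP => j ij.
    have -> : lift ord0 i = lshift n (lift ord0 j) :> 'I_(k.+1 + n).
      by apply: val_inj; rewrite /= ij.
    by rewrite vcat_lshift.
  have -> : lift ord0 i = rshift k.+1 j :> 'I_(k.+1 + n).
    by apply: val_inj; rewrite /= ij.
  by rewrite vcat_rshift.
rewrite /= IHk /=; split=> [H x|H x y _].
  by rewrite -E; apply: H.
have := H (scons y x); rewrite -E scons0.
by congr (sat _ _ (scons _ (vcat _ _))); apply: funext => i; rewrite scons_lift.
Qed.

End Substitution.

(** * Elimination of the imaginary sorts *)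

Section EqElimination.
Variable M : groupType.

Lemma proj_eqP (E : def_equiv M) (x y : 'I_(de_ar E) -> M) :
  proj x = proj y <-> de_rel (d := E) x y.
Proof.
split=> [[E1]|xy].
  have : [set z | de_rel (d := E) y z] y by exact: de_refl.
  by rewrite -E1.
apply: eq_exist; apply/seteqP; split=> z /=; apply: de_trans => //.
exact: de_sym.
Qed.

Definition width (s : eqsort M) : nat := if s is Quot E then de_ar E else 1.

Fixpoint cwidth (c : seq (eqsort M)) : nat :=
  if c is s :: c' then (width s + cwidth c')%N else 0.

(** A relation rather than a chosen representative: an imaginary has many, and an automorphism will
    be seen to fix it by comparing two of them. *)
Definition represents (s : eqsort M) :
    eqcarrier s -> ('I_(width s) -> M) -> Prop :=
  match s return eqcarrier s -> ('I_(width s) -> M) -> Prop with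
  | Home => fun x u => u ord0 = x
  | Quot E => fun x u => proj u = x
  end.

Fixpoint crepresents (c : seq (eqsort M)) :
    eqenv c -> ('I_(cwidth c) -> M) -> Prop :=
  match c return eqenv c -> ('I_(cwidth c) -> M) -> Prop with
  | [::] => fun _ _ => True
  | s :: c' => fun r v => represents r.1 (fun i => v (lshift (cwidth c') i)) /\
                 crepresents r.2 (fun i => v (rshift (width s) i))
  end.

Lemma represents_ex (s : eqsort M) (x : eqcarrier s) :
  exists u, represents x u.
Proof.
case: s x => [x|E [C CE]]; first by exists (fun _ => x).
by case: (CE) => u Cu; exists u; apply: eq_exist.
Qed.

Lemma represents_fun (s : eqsort M) (u : 'I_(width s) -> M) :
  exists x : eqcarrier s, represents x u.
Proof. by case: s u => [|E] u; [exists (u ord0)|exists (proj u)]. Qed.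

Lemma crepresents_cat s c (x : eqcarrier s) (r : eqenv c) u v :
  represents x u -> crepresents r v ->
  crepresents ((x, r) : eqenv (s :: c)) (vcat u v).
Proof.
move=> xu rv; split => /=.
  by have -> : (fun i => vcat u v (lshift _ i)) = u
    by apply: funext => i; rewrite vcat_lshift.
by have -> : (fun i => vcat u v (rshift _ i)) = v
  by apply: funext => i; rewrite vcat_rshift.
Qed.

Lemma eqvar_elim c s (i : eqvar c s) :
  exists f : 'I_(width s) -> 'I_(cwidth c), forall r v,
    crepresents r v -> represents (lookup i r) (fun j => v (f j)).
Proof.
elim: i => {c s} [s c|s s' c i [f fP]].
  by exists (fun j => lshift (cwidth c) j) => r v [].
by exists (fun j => rshift (width s') (f j)) => r v [_ /fP].
Qed.

(** The projection symbol disappears: its arguments, once translated to home terms, form the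
    representing tuple. *)
Lemma eqterm_elim c s (t : eqterm c s) :
  exists ts : 'I_(width s) -> term (cwidth c), forall r v,
    crepresents r v -> represents (eqteval r t) (fun j => teval v (ts j)).
Proof.
elim: t => {s} [s i||t [ts tP] u [us uP]|t [ts tP]|E t IHt].
- have [f fP] := eqvar_elim i.
  by exists (fun j => TVar (f j)) => r v /fP.
- by exists (fun _ => TOne).
- exists (fun _ => TMul (ts ord0) (us ord0)) => r v rv /=.
  by have /= -> := tP _ _ rv; have /= -> := uP _ _ rv.
- exists (fun _ => TInv (ts ord0)) => r v rv /=.
  by have /= -> := tP _ _ rv.
have [F FP] := choice IHt.
exists (fun j => F j ord0) => r v rv /=; congr proj.
by apply: funext => j; exact: FP.
Qed.

(** Equality in a quotient sort becomes the formula defining its equivalence relation, and a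
    quantifier over a sort becomes a block over tuples. The latter is faithful because each element
    has a representative and each tuple represents an element. *)
Lemma eqformula_elim c (phi : eqformula c) :
  exists psi : formula (cwidth c), forall r v,
    crepresents r v -> (eqsat phi r <-> sat setT psi v).
Proof.
elim: phi => {c} [c s t u|c|c p [p' pP] q [q' qP]|c s p [p' pP]].
- have [ts tP] := eqterm_elim t; have [us uP] := eqterm_elim u.
  case: s t u ts tP us uP => [|E] t u ts tP us uP.
    exists (FEq (ts ord0) (us ord0)) => r v rv /=.
    by have /= -> := tP _ _ rv; have /= -> := uP _ _ rv.
  have [phi phiP] := de_def E.
  exists (fsubst phi (vcat ts us)) => r v rv /=.
  have /= <- := tP _ _ rv; have /= <- := uP _ _ rv.
  rewrite proj_eqP phiP sat_subst.
  by rewrite -[joinv _ _]/(vcat _ _) vcat_map.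
- by exists FFalse.
- by exists (FImp p' q') => r v rv /=; rewrite (pP _ _ rv) (qP _ _ rv).
exists (FAlln p') => r v rv; rewrite sat_alln /=; split=> [H u|H x].
  have [x xu] := represents_fun u.
  exact/(pP (x, r))/H/crepresents_cat.
have [u xu] := represents_ex x.
exact/(pP _ _ (crepresents_cat xu rv))/H.
Qed.

End EqElimination.

(** * Homomorphisms from free groups *)

(** Maps live on the whole ambient type but are constrained only on [H], since the free group is a
    subset of [M] and not a type of its own. *)
Definition morph_on (G K : groupType) (H : set G) (f : G -> K) : Prop :=
  forall x y, H x -> H y -> f (x * y) = f x * f y.

Definition aut_of (G : groupType) (H : set G) (f : G -> G) : Prop :=
  [/\ morph_on H f, forall x, H x -> H (f x),
      forall x y, H x -> H y -> f x = f y -> x = y &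
      forall y, H y -> exists2 x, H x & f x = y].

Section Morphisms.
Variables (G K : groupType) (H : set G) (f : G -> K).
Hypotheses (sH : is_subgroup H) (fM : morph_on H f).

Lemma morph_on1 : f 1 = 1.
Proof.
have [H1 _ _] := sH; apply: (mulgI (f 1)).
by rewrite -fM // !mulg1.
Qed.

Lemma morph_onV x : H x -> f x^-1 = (f x)^-1.
Proof.
have [_ _ HV] := sH => Hx; apply: (mulgI (f x)).
by rewrite -fM ?mulgV ?morph_on1 //; apply: HV.
Qed.

Lemma morph_onJ x y : H x -> H y -> f (x ^ y) = f x ^ f y.
Proof.
have [_ HM HV] := sH => Hx Hy.
by rewrite !conjgE !fM ?morph_onV //; [exact: HV|exact: HM].
Qed.

End Morphisms.

Section Generated.
Variable G : groupType.
Implicit Types (A H : set G).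

Lemma generated_subgroup A : is_subgroup (generated A).
Proof.
split=> [H [] //|x y Ax Ay H sH AH|x Ax H sH AH]; case: (sH) => _ HM HV.
  by apply: HM; [exact: Ax|exact: Ay].
by apply: HV; exact: Ax.
Qed.

Lemma sub_generated A : A `<=` generated A.
Proof. by move=> x Ax H _; apply. Qed.

Lemma subgroupJ H x y : is_subgroup H -> H x -> H y -> H (x ^ y).
Proof.
by move=> [_ HM HV] Hx Hy; rewrite conjgE; apply/HM/HM => //; apply: HV.
Qed.

(** The elements of [H] sent into [B] form a subgroup containing [A]. Membership in [H] is carried
    along because [f] is multiplicative only there. *)
Lemma morph_on_stable H A (f : G -> G) :
  is_subgroup H -> morph_on H f -> A `<=` H ->
  forall B, is_subgroup B -> (forall x, A x -> B (f x)) ->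
  forall x, generated A x -> B (f x).
Proof.
move=> sH fM AH B sB fA x Ax.
suff [] : [set y | H y /\ B (f y)] x by [].
case: (sH) (sB) => H1 HM HV [B1 BM BV].
apply: Ax => [|y Ay]; last by split; [exact: AH|exact: fA].
split=> [|y z [Hy By] [Hz Bz]|y [Hy By]]; split; rewrite ?fM //.
- by rewrite (morph_on1 sH fM).
- exact: HM.
- exact: BM.
- exact: HV.
by rewrite (morph_onV sH fM) //; apply: BV.
Qed.

Lemma morph_on_id H A (f : G -> G) :
  is_subgroup H -> morph_on H f -> A `<=` H ->
  (forall x, A x -> f x = x) -> forall x, generated A x -> f x = x.
Proof.
move=> sH fM AH fA x Ax.
suff [] : [set y | H y /\ f y = y] x by [].
case: (sH) => H1 HM HV.
apply: Ax => [|y Ay]; last by split; [exact: AH|exact: fA].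
split=> [|y z [Hy yE] [Hz zE]|y [Hy yE]]; split.
- by [].
- exact: morph_on1 sH fM.
- exact: HM.
- by rewrite fM // yE zE.
- exact: HV.
by rewrite (morph_onV sH fM) // yE.
Qed.

End Generated.

Section Words.
Variables (G : groupType) (I : Type) (e : I -> G).

Lemma word_eval_cat u v :
  word_eval e (u ++ v) = word_eval e u * word_eval e v.
Proof. by elim: u => [|l u IHu] /=; rewrite ?mul1g // IHu mulgA. Qed.

Definition inv_word (w : seq (I * bool)) := rev [seq (l.1, ~~ l.2) | l <- w].

Lemma word_eval_inv w : word_eval e (inv_word w) = (word_eval e w)^-1.
Proof.
elim: w => [|[i b] w IHw]; rewrite /inv_word /= ?invg1 //.
rewrite rev_cons -cats1 word_eval_cat -/(inv_word w) IHw invgM /= mulg1.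
by case: b => //=; rewrite invgK.
Qed.

Lemma generated_word x : generated (range e) x -> exists w, word_eval e w = x.
Proof.
move=> Gx; apply: (Gx [set y | exists w, word_eval e w = y]).
  split=> [|x1 y [u <-] [v <-]|x1 [u <-]].
  - by exists [::].
  - by exists (u ++ v); rewrite word_eval_cat.
  by exists (inv_word u); rewrite word_eval_inv.
by move=> _ [i _ <-]; exists [:: (i, false)]; rewrite /= mulg1.
Qed.

Lemma word_eval_cancel u v i b :
  word_eval e (u ++ (i, b) :: (i, ~~ b) :: v) = word_eval e (u ++ v).
Proof.
by rewrite !word_eval_cat /=; case: b; rewrite /= ?mulKg ?mulVKg.
Qed.

End Words.

(** * The universal property of a free basis *)

Section Universal.
Variables (G : groupType) (H : set G) (I : Type) (e : I -> G).
Hypothesis eH : free_basis H e.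

Lemma free_basis_subgroup : is_subgroup H.
Proof. by case: eH => -> _; exact: generated_subgroup. Qed.

Lemma free_basis_mem i : H (e i).
Proof. by case: eH => -> _; apply: sub_generated; exists i. Qed.

(** Induction on length: a nonempty word with value 1 is not reduced, and deleting a cancelling pair
    changes neither evaluation. *)
Lemma free_basis_word (K : groupType) (f : I -> K) w :
  word_eval e w = 1 -> word_eval f w = 1.
Proof.
have [k] := ubnP (size w); elim: k w => // k IHk w.
have [->|w0] := pselect (w = [::]); first by [].
have [/(proj2 eH w) /(_ w0) //|] := pselect (reduced w).
move=> /existsNP[u] /existsNP[v] /existsNP[i] /existsNP[b] /contrapT ->.
rewrite !word_eval_cancel => wk; apply: IHk; move: wk.
by rewrite !size_cat /= !addnS ltnS => /ltnW.
Qed.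

Lemma free_basis_extend (K : groupType) (f : I -> K) :
  exists2 h : G -> K, morph_on H h & forall i, h (e i) = f i.
Proof.
(* Outside [H] the empty word serves as a default value. *)
have /choice[W WP] : forall x, exists w, H x -> word_eval e w = x.
  move=> x; have [Hx|] := pselect (H x); last by exists [::].
  by case: eH Hx => -> _ /generated_word[w]; exists w.
(* The image does not depend on the chosen word: [u] times the inverse of [v] is a relation among
   the [e i], hence among the [f i]. *)
have eqW u v : word_eval e u = word_eval e v -> word_eval f u = word_eval f v.
  move=> uv; apply: divg1_eq; rewrite -word_eval_inv -word_eval_cat.
  by apply: free_basis_word; rewrite word_eval_cat word_eval_inv uv mulgV.
have [_ HM _] := free_basis_subgroup.
exists (fun x => word_eval f (W x)) => [x y Hx Hy|i].
  rewrite -word_eval_cat; apply: eqW; rewrite word_eval_cat !WP //.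
  exact: HM.
rewrite -[RHS]mulg1; apply: (eqW _ [:: (i, false)]).
by rewrite WP /= ?mulg1 //; apply: free_basis_mem.
Qed.

Lemma free_basis_neq1 i : e i <> 1.
Proof.
have := proj2 eH [:: (i, false)]; rewrite /= mulg1; apply => //.
by move=> [|? [|? ?]].
Qed.

(** [s] lists the images of the basis under the automorphism and [t] those under its inverse. The
    last two hypotheses concern arbitrary extensions, so that a caller only computes on
    generators. *)
Lemma free_basis_aut (s t : I -> G) :
  (forall i, H (s i)) -> (forall i, H (t i)) ->
  (forall h : G -> G, morph_on H h -> (forall i, h (e i) = s i) ->
     forall i, h (t i) = e i) ->
  (forall h : G -> G, morph_on H h -> (forall i, h (e i) = t i) ->
     forall i, h (s i) = e i) ->
  exists2 h, aut_of H h & forall i, h (e i) = s i.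
Proof.
move=> Hs Ht st ts.
have [h hM hE] := free_basis_extend s; have [g gM gE] := free_basis_extend t.
have sH := free_basis_subgroup.
have eH' : range e `<=` H by move=> _ [i _ <-]; exact: free_basis_mem.
have HE x : H x -> generated (range e) x by case: eH => ->.
have stable (f : G -> G) (u : I -> G) :
    morph_on H f -> (forall i, f (e i) = u i) -> (forall i, H (u i)) -> forall x, H x -> H (f x).
  move=> fM fE Hu x /HE; apply: (morph_on_stable sH fM) => //.
  by move=> _ [i _ <-]; rewrite fE.
have comp (f k : G -> G) : morph_on H f -> morph_on H k ->
    (forall x, H x -> H (k x)) -> (forall i, f (k (e i)) = e i) ->
    forall x, H x -> f (k x) = x.
  move=> fM kM kH fk x /HE.
  apply: (morph_on_id (f := f \o k) sH) => // [y z Hy Hz|_ [i _ <-]] /=.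
    by rewrite kM // fM //; apply: kH.
  exact: fk.
have hH := stable h s hM hE Hs; have gH := stable g t gM gE Ht.
have gh := comp g h gM hM hH; have hg := comp h g hM gM gH.
exists h => //; split=> // [x y Hx Hy xy|y Hy].
  rewrite -[x]gh ?xy ?gh // => i; rewrite hE; exact: ts.
exists (g y); first exact: gH.
by apply: hg => // i; rewrite gE; exact: st.
Qed.

End Universal.

(** * Invariance of definable sets *)

(** Injectivity of [h] handles equations, surjectivity onto [H] handles quantifiers. *)
Lemma sat_aut (G : groupType) (H : set G) h n (phi : formula n)
    (v : 'I_n -> G) :
  is_subgroup H -> aut_of H h -> (forall i, H (v i)) ->
  sat H phi v <-> sat H phi (fun i => h (v i)).
Proof.
move=> sH [hM hH hI hS].
have Ht m (w : 'I_m -> G) t : (forall i, H (w i)) ->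
    H (teval w t) /\ teval (fun i => h (w i)) t = h (teval w t).
  have [H1 HM HV] := sH => Hw.
  elim: t => /= [i||t [Ht tE] u [Hu uE]|t [Ht tE]]; split => //.
  - by rewrite (morph_on1 sH hM).
  - exact: HM.
  - by rewrite tE uE hM.
  - exact: HV.
  by rewrite tE (morph_onV sH hM).
elim: phi v => {n} [n t u|n|n p IHp q IHq|n p IHp] v Hv //=.
- have [Hvt ->] := Ht _ _ t Hv; have [Hvu ->] := Ht _ _ u Hv.
  by split=> [->//|]; exact: hI.
- by rewrite IHp // IHq.
have Hs x : H x -> forall i, H (scons x v i).
  by move=> Hx i; rewrite /scons; case: unliftP => [j|] _.
have sE x : (fun i => h (scons x v i)) = scons (h x) (fun i => h (v i)).
  by apply: funext => i; rewrite /scons; case: unliftP.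
split=> [S y /hS[x Hx <-]|S x Hx].
  by rewrite -sE -IHp; [exact: S|exact: Hs].
by rewrite IHp; [rewrite sE; apply/S/hH|exact: Hs].
Qed.

(** Elementarity is applied to the universal formula denying a conjugator, with the conjugator as
    variable 0 and [x], [y] as parameters. *)
Lemma elementary_conj (G : groupType) (H : set G) x y g :
  elementary_sub H [set: G] -> H x -> H y -> y = x ^ g ->
  exists2 g', H g' & y = x ^ g'.
Proof.
move=> [_ _ _ elem] Hx Hy xy.
pose z := TVar (ord0 : 'I_3).
pose phi : formula 2 := FAll (FImp
  (FEq (TVar (lift ord0 ord_max))
       (TMul (TInv z) (TMul (TVar (lift ord0 ord0)) z))) FFalse).
pose v (i : 'I_2) := if i == ord0 then x else y.
have phiP D : sat D phi v <-> forall g', D g' -> y <> x ^ g'.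
  by split=> S g' /S; rewrite /phi /= !scons_lift !scons0.
have /elem E : forall i, H (v i) by move=> i; rewrite /v; case: ifP.
apply: contrapT => N.
have /phiP/E/phiP /(_ g I) // : forall g', H g' -> y <> x ^ g'.
by move=> g' Hg' yE; apply: N; exists g'.
Qed.

Section Invariance.
Variables (M : groupType) (H : set M) (h : M -> M).
Hypotheses (elemH : elementary_sub H [set: M]) (autH : aut_of H h).

(** [h] is an automorphism of [H] only, so it gives no action on the imaginaries of [M]; being fixed
    is tested on a representative inside [H]. *)
Definition fixed_elt : set (eqelt M) :=
  [set b | exists u : 'I_(width (projT1 b)) -> M,
     [/\ forall i, H (u i), represents (projT2 b) u &
         represents (projT2 b) (fun i => h (u i))]].

Lemma fixed_env (A : set (eqelt M)) c (r : eqenv c) :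
  A `<=` fixed_elt -> env_in A r ->
  exists v, [/\ forall i, H (v i), crepresents r v &
                crepresents r (fun i => h (v i))].
Proof.
move=> fA; elim: c r => [|s c IHc] r /=.
  by exists (fun _ => 1); split => // i; case: elemH => -[].
case: r => x r /= [/fA[u /= [Hu xu xhu]] /IHc[v [Hv rv rhv]]].
exists (vcat u v); split.
- by move=> i; rewrite /vcat; case: fintype.split.
- exact: (crepresents_cat (x := x)).
by have := crepresents_cat (x := x) xhu rhv; rewrite vcat_map.
Qed.

(** Translate to a home formula on representatives in [H], descend from [M] to [H] by elementarity,
    apply [h], and come back. *)
Lemma definable_invariant (A : set (eqelt M)) s (X : set (eqcarrier s)) x y u :
  A `<=` fixed_elt -> definable_over A X -> (forall i, H (u i)) ->
  represents x u -> represents y (fun i => h (u i)) -> X x -> X y.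
Proof.
move=> fA [c [phi [r [Ar ->]]]] Hu xu yhu /=.
have [v [Hv rv rhv]] := fixed_env fA Ar.
have [sH _ _ elem] := elemH; have [_ hH _ _] := autH.
have [psi psiP] := eqformula_elim phi.
have Huv i : H (vcat u v i) by rewrite /vcat; case: fintype.split.
rewrite (psiP _ _ (crepresents_cat xu rv)).
rewrite (psiP _ _ (crepresents_cat yhu rhv)) vcat_map -!elem //.
  by rewrite (sat_aut _ sH autH).
by move=> i; apply: hH.
Qed.

End Invariance.

(** Otherwise [f] is injective and its preimage of [X], which is all of [nat], would be finite. *)
Lemma finite_set_repeat T (X : set T) (f : nat -> T) :
  finite_set X -> (forall k, X (f k)) -> exists j k, j <> k /\ f j = f k.
Proof.
move=> finX fX; apply: contrapT => N; apply: infinite_nat.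
have := @finite_preimage _ _ X f; rewrite (_ : f @^-1` X = setT).
  apply => // j k _ _ jk; apply: contrapT => njk; apply: N.
  by exists j, k.
by apply/seteqP; split=> // k _; exact: fX.
Qed.

(** * The wreath product by Z/2 *)

Definition wreath2 (G : groupType) : Type := (bool * (G * G))%type.

HB.instance Definition _ (G : groupType) := Choice.on (wreath2 G).

Section Wreath.
Variable G : groupType.
Implicit Types x y z : wreath2 G.

Definition swap_if (b : bool) (p : G * G) := if b then (p.2, p.1) else p.

(** The Z/2 part of the right factor permutes the coordinates of the left one, so conjugating by the
    pure swap exchanges coordinates. *)
Definition wreath_mul x y : wreath2 G :=
  (x.1 (+) y.1, ((swap_if y.1 x.2).1 * y.2.1, (swap_if y.1 x.2).2 * y.2.2)).
Definition wreath_inv x : wreath2 G := (x.1, swap_if x.1 (x.2.1^-1, x.2.2^-1)).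
Definition wreath_one : wreath2 G := (false, (1, 1)).

Lemma wreath_mulA : associative wreath_mul.
Proof.
move=> [a [p q]] [b [r s]] [c [t u]]; rewrite /wreath_mul /=.
by case: a; case: b; case: c; rewrite /= !mulgA.
Qed.

Lemma wreath_mul1 : left_id wreath_one wreath_mul.
Proof. by move=> [[] [p q]]; rewrite /wreath_mul /= !mul1g. Qed.

Lemma wreath_mulr1 : right_id wreath_one wreath_mul.
Proof. by move=> [[] [p q]]; rewrite /wreath_mul /= !mulg1. Qed.

Lemma wreath_mulV : left_inverse wreath_one wreath_inv wreath_mul.
Proof. by move=> [[] [p q]]; rewrite /wreath_mul /= !mulVg. Qed.

Lemma wreath_mulrV : right_inverse wreath_one wreath_inv wreath_mul.
Proof. by move=> [[] [p q]]; rewrite /wreath_mul /= !mulgV. Qed.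

HB.instance Definition _ := isGroup.Build (wreath2 G)
  wreath_mulA wreath_mul1 wreath_mulr1 wreath_mulV wreath_mulrV.

End Wreath.

(** * Partial conjugations and exchanges of generators *)

Section Ambient.
Variables (M : groupType) (e : nat -> M) (n : nat).
Hypothesis eF : free_basis (Fomega e) e.

Let sF : is_subgroup (Fomega e).
Proof. exact: free_basis_subgroup eF. Qed.

Let eFi i : Fomega e (e i).
Proof. exact: free_basis_mem eF i. Qed.

Lemma Fk_Fomega k : Fk e k `<=` Fomega e.
Proof.
by move=> x; apply; [exact: generated_subgroup|move=> _ [i _ <-]].
Qed.

Let gen_sub k : [set e i | i in [set i | (i < k)%N]] `<=` Fomega e.
Proof. by move=> _ [i _ <-]. Qed.

(** The inverse conjugates by the inverse of the same generator, which both maps fix because its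
    index [(n + k).+1] exceeds [n]. *)
Lemma conj_aut_ex k : exists2 h, aut_of (Fomega e) h &
  forall i, h (e i) = if i == n then e n ^ e (n + k).+1 else e i.
Proof.
have [_ _ FV] := sF.
have nk : ((n + k).+1 == n) = false by rewrite gtn_eqF // ltnS leq_addr.
apply: (free_basis_aut eF (t := fun i =>
  if i == n then e n ^ (e (n + k).+1)^-1 else e i))
  => [i|i|h hM hE i|h hM hE i].
- by case: ifP => // _; apply: (subgroupJ sF).
- by case: ifP => // _; apply: (subgroupJ sF) => //; apply: FV.
- case: (eqVneq i n) => [->|ni]; last by rewrite hE (negPf ni).
  rewrite (morph_onJ sF hM) ?(morph_onV sF hM) ?hE ?eqxx ?nk ?conjgK //.
  exact: FV.
- case: (eqVneq i n) => [->|ni]; last by rewrite hE (negPf ni).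
  by rewrite (morph_onJ sF hM) ?hE ?eqxx ?nk ?conjgKV.
Qed.

(** The transposition [s] of indices is its own inverse, so it gives both families of images; for
    [k = 0] it is the identity. *)
Lemma swap_aut_ex k : exists2 h, aut_of (Fomega e) h &
  (forall i, (i < n)%N -> h (e i) = e i) /\ h (e n) = e (n + k)%N.
Proof.
pose s i := if i == n then (n + k)%N else if i == (n + k)%N then n else i.
have ss i : s (s i) = i.
  rewrite /s; case: (eqVneq i n) => [->|i1].
    by rewrite eqxx; case: eqP.
  by case: (eqVneq i (n + k)%N) => [->|i2]; rewrite ?eqxx //
    (negPf i1) (negPf i2).
have es (h : M -> M) : morph_on (Fomega e) h ->
    (forall i, h (e i) = e (s i)) -> forall i, h (e (s i)) = e i.
  by move=> hM hE i; rewrite hE ss.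
have [h hA hE] := free_basis_aut eF (fun i => eFi (s i)) (fun i => eFi (s i))
  es es.
exists h => //; split=> [i lin|]; rewrite hE /= /s ?eqxx //.
by rewrite !ltn_eqF // (leq_trans lin) // leq_addr.
Qed.

(** Kill [e i] and keep the other generators: if [i <> j], a conjugate of [e j] would equal 1. *)
Lemma conj_basis_inj g i j : Fomega e g -> e i = e j ^ g -> i = j.
Proof.
move=> Fg ij; apply/eqP; apply: contrapT => /negP nij.
have [h hM hE] := free_basis_extend eF (fun k => if k == i then 1 else e k).
move: (congr1 h ij); rewrite (morph_onJ sF hM) // !hE eqxx eq_sym (negPf nij).
by move=> /esym/eqP; rewrite conjg_eq1 => /eqP; apply: free_basis_neq1 eF _.
Qed.

(** The images of [hj a] and [hk a] in the wreath product have first coordinates [a] and [p a].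
    Hence [a = p a], and [p] maps F_{n+1} into F_n. *)
Lemma conj_aut_separates j k hj hk a : j <> k -> Fk e n.+1 a ->
  aut_of (Fomega e) hj -> aut_of (Fomega e) hk ->
  (forall i, hj (e i) = if i == n then e n ^ e (n + j).+1 else e i) ->
  (forall i, hk (e i) = if i == n then e n ^ e (n + k).+1 else e i) ->
  hj a = hk a -> Fk e n a.
Proof.
move=> njk Fa [jM jF _ _] [kM kF _ _] hjE hkE hjk.
have [_ FM FV] := sF; have F1 : Fomega e 1 by case: sF.
have [p pM pE] := free_basis_extend eF (fun i => if i == n then 1 else e i).
(* The swap sits at the conjugator used by [hk]; the one used by [hj] goes to 1 since [j <> k]. *)
pose q i : wreath2 M :=
  if (i <= n)%N then (false, (e i, 1)) : wreath2 M else
  if i == (n + k).+1 then (true, (1, 1)) : wreath2 M else 1.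
have [f fM fE] := free_basis_extend eF q.
have qle i : (i <= n)%N -> q i = (false, (e i, 1)) by rewrite /q => ->.
have qgt i : q (n + i).+1 = if i == k then (true, (1, 1)) : wreath2 M else 1.
  by rewrite /q ltnNge leq_addr eqSS eqn_add2l.
have fj : f (hj a) = (false, (a, 1)).
  suff [] : [set x | Fomega e x /\ f (hj x) = (false, (x, 1))] a by [].
  apply: Fa.
    split=> [|x y [Fx xE] [Fy yE]|x [Fx xE]]; split.
    - by [].
    - by rewrite (morph_on1 sF jM) (morph_on1 sF fM).
    - exact: FM.
    - rewrite jM // fM ?xE ?yE; [|exact: jF..].
      by congr (_, (_, _)); rewrite /= mulg1.
    - exact: FV.
    - rewrite (morph_onV sF jM) // (morph_onV sF fM) ?xE; last exact: jF.
      by congr (_, (_, _)); rewrite /= invg1.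
  move=> _ [i /= ilt <-]; split; first by [].
  rewrite hjE; case: eqVneq => [->|ni]; last by rewrite fE qle.
  rewrite (morph_onJ sF fM) // !fE qle // qgt.
  by have /eqP/negPf-> := njk; rewrite conjg1.
(* The second coordinate is left unspecified: it collects the occurrences of [e n], and only first
   coordinates are compared. *)
have fk : exists y, f (hk a) = (false, (p a, y)).
  suff [] : [set x | Fomega e x /\ exists y, f (hk x) = (false, (p x, y))] a
    by [].
  apply: Fa.
    split=> [|x y [Fx [x' xE]] [Fy [y' yE]]|x [Fx [x' xE]]]; split.
    - by [].
    - exists 1.
      by rewrite (morph_on1 sF kM) (morph_on1 sF fM) (morph_on1 sF pM).
    - exact: FM.
    - exists (x' * y'); rewrite kM // fM ?xE ?yE; [|exact: kF..].
      by rewrite pM.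
    - exact: FV.
    - exists x'^-1.
      rewrite (morph_onV sF kM) // (morph_onV sF fM) ?xE; last exact: kF.
      by rewrite (morph_onV sF pM).
  move=> _ [i /= ilt <-]; split; first by [].
  rewrite hkE pE; case: eqVneq => [_|ni].
    (* Conjugation by the swap moves [e n] to the second coordinate, in agreement with
       [p (e n) = 1]. *)
    exists (e n); rewrite (morph_onJ sF fM) // !fE qle // qgt eqxx.
    by rewrite conjgE; congr (_, (_, _)); rewrite /= invg1 !mul1g ?mulg1.
  by exists 1; rewrite fE qle.
have pa : Fk e n (p a).
  apply: (morph_on_stable sF pM _ (generated_subgroup _) _ Fa) => //.
  move=> _ [i /= ilt <-]; rewrite pE; case: eqVneq => [_|ni].
    by case: (generated_subgroup [set e i | i in [set i | (i < n)%N]]).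
  by apply: sub_generated; exists i => //=; rewrite ltn_neqAle ni -ltnS.
by case: fk => y; rewrite -hjk fj => -[->].
Qed.

End Ambient.

(** * Algebraicity of the tuple and of the conjugacy class *)

Lemma fixed_real (M : groupType) (H : set M) h (x : M) :
  H x -> h x = x -> fixed_elt H h (real x).
Proof. by move=> Hx hx; exists (fun _ => x); split. Qed.

Theorem theoremA1 (M : groupType) (e : nat -> M) (hM : ambient_model e)
    (n : nat) (hn : (2 <= n)%N)
    (m : nat) (a : 'I_m -> M) (ha : forall i, Fk e n.+1 (a i)) :
  ~ ((forall i,
        acleq ([set real x | x in Fk e n] `|` [set conj_class (e n)])
          (real (a i))) /\
     acleq ([set real x | x in Fk e n] `|` [set real (a i) | i in [set: 'I_m]])
       (conj_class (e n))).
Proof.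
have eF := am_basis hM; have elemF := am_elementary hM.
have sF := free_basis_subgroup eF; have eFi := free_basis_mem eF.
have fixFn h : aut_of (Fomega e) h -> (forall i, (i < n)%N -> h (e i) = e i) ->
    forall x, Fk e n x -> fixed_elt (Fomega e) h (real x).
  move=> [hM' _ _ _] hE x Fx; apply: fixed_real; first exact: Fk_Fomega Fx.
  apply: (morph_on_id sF hM') Fx => _ [i /= lin <-] //; exact: hE.
case=> acl_a [X /= [Xdef Xfin Xe]].
(* Once the tuple lies in F_n, all parameters of the second algebraicity are fixed by every
   automorphism that fixes F_n. *)
have Fa i : Fk e n (a i).
  have [Y /= [Ydef Yfin Ya]] := acl_a i.
  have /choice[h hP] : forall k, exists h, aut_of (Fomega e) h /\
      forall i, h (e i) = if i == n then e n ^ e (n + k).+1 else e i.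
    by move=> k; have [h hA hE] := conj_aut_ex n eF k; exists h.
  (* The finite set [Y] contains [h k (a i)] for every [k], which is shown last; a repetition among
     these values puts [a i] in F_n. *)
  have [k|j [k [njk hjk]]] :=
      finite_set_repeat (f := fun k => h k (a i)) Yfin; last first.
    have [jA jE] := hP j; have [kA kE] := hP k.
    exact: conj_aut_separates njk (ha i) jA kA jE kE hjk.
  have [kA kE] := hP k.
  apply: (definable_invariant (s := Home M) elemF kA _ Ydef
    (u := fun _ => a i) _ _ _ Ya) => //; last first.
    by move=> _; exact: Fk_Fomega (ha i).
  move=> _ [[x Fx <-]|->].
    by apply: fixFn => // l lin; rewrite kE ltn_eqF.
  (* The class is fixed although [e n] moves, since the image of [e n] is a conjugate. *)
  exists (fun _ => e n); split => //=; apply/proj_eqP.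
  rewrite kE eqxx; apply: conj_rel_sym; by exists (e (n + k).+1).
(* [X] contains the classes of all [e (n + k)], so two of them coincide for distinct indices. *)
have [k|j [k [njk]]] := finite_set_repeat
    (f := fun k => proj (E := E1 M) (fun _ => e (n + k)%N)) Xfin.
  have [h hA [hE hn']] := swap_aut_ex n eF k.
  apply: (definable_invariant (s := Quot (E1 M)) elemF hA _ Xdef
    (u := fun _ => e n) _ _ _ Xe) => //=; last by rewrite hn'.
  by move=> _ [[x Fx <-]|[i _ <-]]; apply: fixFn.
move=> /proj_eqP[g /= jk]; apply: njk; apply/eqP; rewrite -(eqn_add2l n).
(* The conjugator comes from [M]; elementarity replaces it by one in the free group, where
   generators can be killed. *)
have [g' Fg' jk'] := elementary_conj elemF (eFi _) (eFi _) jk.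
by rewrite (conj_basis_inj eF Fg' jk').
Qed.
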